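(* Let $d\ge 1$. Let $F\colon\mathbb{R}\to\left]-\infty,+\infty\right]$ be a lower semicontinuous convex function such that the interior of $\operatorname{dom}F$ is $\left]0,+\infty\right[$, $F$ is differentiable in $\left]0,+\infty\right[$, and $L_0:=\lim_{\xi\downarrow 0}F'(\xi)\in\mathbb{R}\cup\{-\infty\}$. Let $\Psi\colon\mathbb{R}\times\mathbb{R}^d\to\left]-\infty,+\infty\right]$ be given by $\Psi(\rho,\boldsymbol{m})=F(\rho)$. Let $\alpha>0$, $k>0$, and define $\Phi^{\alpha,k}_c\colon\mathbb{R}\times\mathbb{R}^d\to\left]-\infty,+\infty\right]$ by $$\Phi^{\alpha,k}_c(\rho,\boldsymbol{m})=\begin{cases}\dfrac{k^2}{\alpha}\left(\rho-\sqrt{\rho^2-\left|\dfrac{\boldsymbol{m}}{k}\right|^2}\right),&\text{if }\left|\dfrac{\boldsymbol{m}}{k}\right|\le\rho;\\ +\infty,&\text{otherwise}.\end{cases}$$ Then, for every $\gamma>0$ and every $(\rho,\boldsymbol{m})\in\mathbb{R}\times\mathbb{R}^d$, $$\operatorname{Prox}_{\gamma(\Phi^{\alpha,k}_c+\Psi)}(\rho,\boldsymbol{m})=\begin{cases}(0,0),&\text{if }\rho+\sqrt{\left(\frac{\gamma k^2}{\alpha}\right)^2+k^2|\boldsymbol{m}|^2}-\frac{\gamma k^2}{\alpha}\le\gamma L_0;\\[2mm](\theta,\boldsymbol{v}),&\text{if }\rho+\sqrt{\left(\frac{\gamma k^2}{\alpha}\right)^2+k^2|\boldsymbol{m}|^2}-\frac{\gamma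 k^2}{\alpha}>\gamma L_0,\end{cases}$$ where, in the second case, $\operatorname{Prox}_{\gamma F}\rho\ge 0$ and $\theta$ is the unique solution $t=\theta$ to $R(t)=0$ among $t>0$ with $t\ge\operatorname{Prox}_{\gamma F}\rho$, where $$R(t)=\left(\frac{(1+k^2)t+\gamma F'(t)-\rho+\frac{\gamma k^2}{\alpha}}{t+\gamma F'(t)-\rho+\frac{\gamma k^2}{\alpha}}\right)\sqrt{\left(t+\gamma F'(t)-\rho+\frac{\gamma k^2}{\alpha}\right)^2-\left(\frac{\gamma k^2}{\alpha}\right)^2}-k|\boldsymbol{m}|,$$ and $$\boldsymbol{v}=\left(\frac{\theta k^2}{(1+k^2)\theta+\gamma F'(\theta)-\rho+\frac{\gamma k^2}{\alpha}}\right)\boldsymbol{m}.$$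
   Context: $|\cdot|$ denotes the Euclidean norm. For $f\colon\mathbb{R}^M\to\left]-\infty,+\infty\right]$, $\operatorname{dom}f=\{x: f(x)<+\infty\}$. For $f$ proper, convex and lower semicontinuous, the proximity operator is $\operatorname{Prox}_f x=\arg\min_{y\in\mathbb{R}^M}\big(f(y)+\tfrac12|y-x|^2\big)$, which is the unique minimizer. The inequality $\,\cdot\le\gamma L_0$ is never satisfied by a real number when $L_0=-\infty$ (so the second case always applies then). *)

(* Defs.v *)
From HB Require Import structures.
From mathcomp Require Import all_boot all_order all_algebra.
From mathcomp Require Import all_classical all_reals all_analysis.

Set Implicit Arguments.
Unset Strict Implicit.
Unset Printing Implicit Defensive.

Import Order.TTheory GRing.Theory Num.Theory.
Import numFieldNormedType.Exports.

Local Open Scope classical_set_scope.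
Local Open Scope ring_scope.

(* The library norms on ['rV[R]_d] and on products are sup norms, hence the
   explicit Euclidean norms below. *)
Definition enorm (R : realType) (d : nat) (m : 'rV[R]_d) : R :=
  Num.sqrt (\sum_(i < d) m ord0 i ^+ 2).

Definition pair_enorm (R : realType) (d : nat) (x : R * 'rV[R]_d) : R :=
  Num.sqrt (x.1 ^+ 2 + enorm x.2 ^+ 2).

Definition edom (R : realType) (T : Type) (f : T -> \bar R) : set T :=
  [set x | (f x < +oo)%E].

Definition econvex (R : realType) (f : R -> \bar R) : Prop :=
  forall x y t : R, 0 < t -> t < 1 ->
    (f (t * x + (1 - t) * y)%R <= t%:E * f x + (1 - t)%:E * f y)%E.

Definition argmin (R : realType) (T : Type) (f : T -> \bar R) : set T :=
  [set y | forall z, (f y <= f z)%E].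

(* [nrm] is meant to be the Euclidean norm of [V]. *)
Definition prox_set (R : realType) (V : zmodType) (nrm : V -> R)
    (f : V -> \bar R) (x : V) : set V :=
  argmin (fun y => f y + (2^-1 * nrm (y - x) ^+ 2)%:E)%E.

(* The default value [0] is only reached when [prox_set nrm f x] is empty. *)
Definition prox (R : realType) (V : zmodType) (nrm : V -> R)
    (f : V -> \bar R) (x : V) : V :=
  xget 0 (prox_set nrm f x).

(* [fine] identifies [F] with a real function near the points where it is
   finite. *)
Definition ederive (R : realType) (F : R -> \bar R) : R -> R :=
  derive1 (fine \o F).

Definition Psi (R : realType) (d : nat) (F : R -> \bar R) :
    R * 'rV[R]_d -> \bar R :=
  fun x => F x.1.

Definition Phi (R : realType) (d : nat) (alpha k : R) :
    R * 'rV[R]_d -> \bar R :=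
  fun x =>
    if enorm (k^-1 *: x.2) <= x.1 then
      (k ^+ 2 / alpha
        * (x.1 - Num.sqrt (x.1 ^+ 2 - enorm (k^-1 *: x.2) ^+ 2)))%:E
    else +oo%E.

Definition threshold (R : realType) (d : nat) (alpha k gamma rho : R)
    (m : 'rV[R]_d) : R :=
  rho + Num.sqrt ((gamma * k ^+ 2 / alpha) ^+ 2 + k ^+ 2 * enorm m ^+ 2)
  - gamma * k ^+ 2 / alpha.

Definition Rfun (R : realType) (d : nat) (F : R -> \bar R)
    (alpha k gamma rho : R) (m : 'rV[R]_d) (t : R) : R :=
  ((1 + k ^+ 2) * t + gamma * ederive F t - rho + gamma * k ^+ 2 / alpha)
  / (t + gamma * ederive F t - rho + gamma * k ^+ 2 / alpha)
  * Num.sqrt ((t + gamma * ederive F t - rho + gamma * k ^+ 2 / alpha) ^+ 2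
              - (gamma * k ^+ 2 / alpha) ^+ 2)
  - k * enorm m.

Definition vsol (R : realType) (d : nat) (F : R -> \bar R)
    (alpha k gamma rho : R) (m : 'rV[R]_d) (theta : R) : 'rV[R]_d :=
  (theta * k ^+ 2
   / ((1 + k ^+ 2) * theta + gamma * ederive F theta - rho
      + gamma * k ^+ 2 / alpha)) *: m.

(* Main.v *)
Require Import Defs.
From HB Require Import structures.
From mathcomp Require Import all_boot all_order all_algebra.
From mathcomp Require Import all_classical all_reals all_analysis.
From mathcomp Require Import ring lra.

Set Implicit Arguments.
Unset Strict Implicit.
Unset Printing Implicit Defensive.

Import Order.TTheory GRing.Theory Num.Theory.
Import numFieldNormedType.Exports.

Local Open Scope classical_set_scope.
Local Open Scope ring_scope.

(** Write [c = gamma k^2 / alpha] and [D(t) = t + gamma F'(t) - rho + c], so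
    that [R(t) = ((k^2 t + D(t)) / D(t)) sqrt (D(t)^2 - c^2) - k |m|].

    The proximal points are exhibited and then certified. If a point [y]
    satisfies the first-order optimality condition for
    [f + |. - x|^2 / 2], then expanding the square gives, for every [z],
    [f y + |y - x|^2 / 2 + |z - y|^2 / 2 <= f z + |z - x|^2 / 2],
    so that [y] is the unique minimizer ([prox_set_eq1]). This settles existence
    and uniqueness together, without any compactness argument.

    The certificates are:
    - in one dimension, a subgradient [p] of [F] at [y] with
      [y + gamma p = rho] ([prox_subgradient]);
    - at a root [theta] of [R] with [D(theta) >= c], the tangent inequality for
      [F] together with the reverse Cauchy-Schwarz inequality in the cone
      [|u| <= t], which is the tangent inequality for the convex function
      [t - sqrt (t^2 - |u|^2)] ([prox_pair_pos]);
    - at [(0, 0)], the subgradient [L0] of [F] at 0, obtained from lower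
      semicontinuity, together with Cauchy-Schwarz in the plane
      ([prox_pair_zero]).

    It remains to find a root in the second case. The derivative [F'] is
    nondecreasing and continuous ([ederive_le], [ederive_continuous]), hence
    [D] is continuous with slope at least 1, and [D >= c] at and beyond
    [Prox_(gamma F) rho] ([Dfun_ge_prox]). So [R] is eventually nonnegative. It
    is nonpositive at [Prox_(gamma F) rho] when this point is positive, since
    [D = c] there. When this point is 0, the threshold inequality says that the
    limit of [R] at [0+] is negative. The intermediate value theorem applies in
    both cases ([Rfun_exists_root]). Any two admissible roots give the same
    proximal point, so the root is unique; the monotonicity of [R] is not
    needed. *)

(** * Two facts on the real line *)

Lemma root_itv (R : realType) (f : R -> R) a b : a <= b ->
  (forall x, a <= x -> {for x, continuous f}) -> f a <= 0 -> 0 <= f b ->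
  exists2 c, a <= c & f c = 0.
Proof.
move=> ab fc fa fb.
have [] := @IVT R f a b 0 ab.
- apply: continuous_in_subspaceT => x; rewrite inE/= in_itv/= => /andP[ax _].
  exact: fc.
- by rewrite ge_min fa le_max fb orbT.
- by move=> c; rewrite in_itv/= => /andP[ac _] fc0; exists c.
Qed.

Lemma lte_EFin_dense (R : realType) (L : \bar R) (c : R) : (L < c%:E)%E ->
  exists2 b, (L < b%:E)%E & b < c.
Proof.
case: L => [l| |] //; rewrite ?lte_fin => Lc.
  by exists ((l + c) / 2); rewrite ?lte_fin; lra.
by exists (c - 1); rewrite ?ltNyr//; lra.
Qed.

(** * Euclidean geometry of row vectors *)

(** The Euclidean inner product, for which [enorm u ^+ 2 = dotv u u]. *)
Definition dotv (R : realType) (d : nat) (u v : 'rV[R]_d) : R :=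
  \sum_(i < d) u ord0 i * v ord0 i.

Section Euclid.
Context {R : realType} {d : nat}.
Implicit Types (u v w : 'rV[R]_d) (a : R).

Lemma enorm_ge0 u : 0 <= enorm u.
Proof. exact: sqrtr_ge0. Qed.

Lemma enorm_sqr u : enorm u ^+ 2 = dotv u u.
Proof.
by rewrite sqr_sqrtr ?sumr_ge0// => i _; rewrite sqr_ge0.
Qed.

Lemma enorm_eq0 u : enorm u = 0 -> u = 0.
Proof.
move=> u0; have := enorm_sqr u; rewrite u0 expr0n/= => /esym/eqP.
rewrite psumr_eq0 => [/allP h|i _]; last by rewrite -expr2 sqr_ge0.
apply/rowP => i; rewrite mxE.
have := h i (mem_index_enum _) => /=.
by rewrite -expr2 sqrf_eq0 => /eqP.
Qed.

Lemma enorm0 : enorm (0 : 'rV[R]_d) = 0.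
Proof.
by rewrite /enorm big1 ?sqrtr0// => i _; rewrite mxE expr0n.
Qed.

Lemma enormZ a u : enorm (a *: u) = `|a| * enorm u.
Proof.
rewrite /enorm -sqrtr_sqr -sqrtrM ?sqr_ge0// mulr_sumr.
by congr Num.sqrt; apply: eq_bigr => i _; rewrite mxE exprMn.
Qed.

Lemma dotvC u v : dotv u v = dotv v u.
Proof. by apply: eq_bigr => i _; rewrite mulrC. Qed.

Lemma dotvZr a u v : dotv u (a *: v) = a * dotv u v.
Proof. by rewrite mulr_sumr; apply: eq_bigr => i _; rewrite mxE mulrCA. Qed.

Lemma dotvZl a u v : dotv (a *: u) v = a * dotv u v.
Proof. by rewrite dotvC dotvZr dotvC. Qed.

Lemma enormB_sqr u v :
  enorm (u - v) ^+ 2 = enorm u ^+ 2 - 2 * dotv u v + enorm v ^+ 2.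
Proof.
rewrite !enorm_sqr /dotv mulr_sumr -sumrN -!big_split/=.
by apply: eq_bigr => i _; rewrite !mxE; ring.
Qed.

(** Cauchy-Schwarz inequality. *)
Lemma dotv_le u v : dotv u v <= enorm u * enorm v.
Proof.
have [u0|u0] := eqVneq (enorm u) 0.
  by rewrite (enorm_eq0 u0) enorm0 mul0r /dotv big1// => i _; rewrite mxE mul0r.
have [v0|v0] := eqVneq (enorm v) 0.
  by rewrite (enorm_eq0 v0) enorm0 mulr0 /dotv big1// => i _; rewrite mxE mulr0.
have ugt0 : 0 < enorm u by rewrite lt0r u0 enorm_ge0.
have vgt0 : 0 < enorm v by rewrite lt0r v0 enorm_ge0.
have uv0 : 0 < enorm u * enorm v by rewrite mulr_gt0.
(* the square of the norm of [|v| u - |u| v] is nonnegative *)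
have := sqr_ge0 (enorm (enorm v *: u - enorm u *: v)).
rewrite enormB_sqr dotvZl dotvZr !enormZ !ger0_norm ?enorm_ge0//.
set a := enorm u in ugt0 uv0 *; set b := enorm v in vgt0 uv0 *.
move=> h; have : 0 <= (a * b) * (a * b - dotv u v) by nra.
by rewrite pmulr_rge0// subr_ge0.
Qed.

(** Reverse Cauchy-Schwarz inequality for the Lorentz form, in the cone
    [enorm u <= s]. *)
Lemma reverse_dotv_le s t u v : enorm u <= s -> enorm v <= t ->
  Num.sqrt (s ^+ 2 - enorm u ^+ 2) * Num.sqrt (t ^+ 2 - enorm v ^+ 2)
    <= s * t - dotv u v.
Proof.
move=> us vt; have := dotv_le u v.
have := enorm_ge0 u; have := enorm_ge0 v.
set a := enorm u in us *; set b := enorm v in vt * => b0 a0 duv.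
have sa : 0 <= s ^+ 2 - a ^+ 2 by nra.
have tb : 0 <= t ^+ 2 - b ^+ 2 by nra.
apply: (@le_trans _ _ (s * t - a * b)); last by lra.
have ab : 0 <= s * t - a * b by nra.
rewrite -sqrtrM// -[leRHS]ger0_norm// -sqrtr_sqr ler_wsqrtr//.
have := sqr_ge0 (s * b - a * t); nra.
Qed.

End Euclid.

Lemma pair_enorm_sqr (R : realType) (d : nat) (x : R * 'rV[R]_d) :
  pair_enorm x ^+ 2 = x.1 ^+ 2 + enorm x.2 ^+ 2.
Proof. by rewrite sqr_sqrtr// addr_ge0// sqr_ge0. Qed.

Lemma pair_enorm_eq0 (R : realType) (d : nat) (x : R * 'rV[R]_d) :
  pair_enorm x = 0 -> x = 0.
Proof.
case: x => t v x0; have := pair_enorm_sqr (t, v); rewrite x0 expr0n/=.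
move=> /esym/eqP; rewrite paddr_eq0 ?sqr_ge0// !sqrf_eq0.
by move=> /andP[/eqP-> /eqP/enorm_eq0->].
Qed.

(** * Certificates for proximal points *)

Section Prox.
Context {R : realType}.

(** Quadratic growth at [y] makes [y] the unique proximal point; neither
    convexity of [f] nor a triangle inequality for [nrm] is used. *)
Lemma prox_set_eq1 (V : zmodType) (nrm : V -> R) (f : V -> \bar R) (x y : V) :
  (forall z, nrm z = 0 -> z = 0) -> f y \is a fin_num ->
  (forall z, (f y + (2^-1 * nrm (y - x) ^+ 2 + 2^-1 * nrm (z - y) ^+ 2)%:E
             <= f z + (2^-1 * nrm (z - x) ^+ 2)%:E)%E) ->
  prox_set nrm f x = [set y].
Proof.
move=> nrm0 fy h; apply/seteqP; split => [z|z ->] /=; last first.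
  move=> w; apply: le_trans (h w); apply: leeD2l.
  by rewrite lee_fin lerDl mulr_ge0// ?sqr_ge0// invr_ge0.
move=> /(_ y)/(le_trans (h z)).
rewrite -(fineK fy) -!EFinD lee_fin => hz.
apply/eqP; rewrite -subr_eq0; apply/eqP/nrm0/eqP.
rewrite -sqrf_eq0 eq_le sqr_ge0 andbT; lra.
Qed.

Lemma prox_eq (V : zmodType) (nrm : V -> R) (f : V -> \bar R) (x y : V) :
  prox_set nrm f x = [set y] -> prox nrm f x = y.
Proof. by move=> h; rewrite /prox h; apply: xget_subset1 => // a b -> ->. Qed.

(** [p] is a subgradient of [F] at [y]; the variable [t] ranges over the whole
    line, and the inequality is trivial where [F t = +oo]. *)
Definition subgradient (F : R -> \bar R) (y p : R) : Prop :=
  forall t, (F y + (p * (t - y))%:E <= F t)%E.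

Lemma prox_subgradient (F : R -> \bar R) (gamma rho y p : R) :
  (forall x, F x != -oo%E) -> 0 < gamma ->
  F y \is a fin_num -> subgradient F y p -> y + gamma * p = rho ->
  prox_set Num.norm (fun x => (gamma%:E * F x)%E) rho = [set y].
Proof.
move=> FNy g0 Fy Fp yp; apply: prox_set_eq1 => [z /normr0_eq0//||z].
  by rewrite fin_numM.
move: (Fp z) (FNy z); case: (F z) => [a| |] // h _; last first.
  by rewrite gt0_muley ?lte_fin// addye// leey.
move: Fy h; case: (F y) => [b| |] // _.
rewrite -!EFinM -!EFinD !lee_fin !real_normK ?num_real// => h.
have {}h : gamma * (b + p * (z - y)) <= gamma * a by rewrite ler_pM2l.
nra.
Qed.

(** Reduction of the two-variable problem to a real inequality, over the points
    where the objective is finite. *)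
Lemma prox_pair (d : nat) (F : R -> \bar R) (alpha k gamma rho theta : R)
    (m v : 'rV[R]_d) :
  (forall x, F x != -oo%E) -> 0 < gamma ->
  F theta \is a fin_num -> enorm (k^-1 *: v) <= theta ->
  (forall t w, F t \is a fin_num -> enorm (k^-1 *: w) <= t ->
     gamma * k ^+ 2 / alpha
       * (theta - Num.sqrt (theta ^+ 2 - enorm (k^-1 *: v) ^+ 2))
     + gamma * fine (F theta)
     + 2^-1 * ((theta - rho) ^+ 2 + enorm (v - m) ^+ 2)
     + 2^-1 * ((t - theta) ^+ 2 + enorm (w - v) ^+ 2)
     <= gamma * k ^+ 2 / alpha
       * (t - Num.sqrt (t ^+ 2 - enorm (k^-1 *: w) ^+ 2))
     + gamma * fine (F t) + 2^-1 * ((t - rho) ^+ 2 + enorm (w - m) ^+ 2)) ->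
  prox_set (@pair_enorm R d)
    (fun x => (gamma%:E * (Phi alpha k x + Psi F x))%E) (rho, m)
    = [set (theta, v)].
Proof.
move=> FNy g0 Ft vt h; apply: prox_set_eq1 => [z /pair_enorm_eq0//||].
  by rewrite /Phi /Psi /= vt fin_numM// fin_numD Ft.
case=> t w; rewrite /Phi /Psi /= vt.
have [wt|wt] := leP (enorm (k^-1 *: w)) t; last first.
  rewrite addye// gt0_muley ?lte_fin// addye// leey//.
have := FNy t; case E : (F t) => [a| |] // _; last first.
  by rewrite addey// gt0_muley ?lte_fin// addye// leey.
have := h t w; rewrite E => /(_ isT wt).
rewrite -(fineK Ft) -!EFinD -?EFinM -?EFinD lee_fin !pair_enorm_sqr /=.
set A := _ * (theta - _); set B := _ * (t - _).
set A' := k ^+ 2 / alpha * (theta - _); set B' := _ * (t - Num.sqrt _).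
have -> : A = gamma * A' by rewrite /A /A' !mulrA.
have -> : B = gamma * B' by rewrite /B /B' !mulrA.
lra.
Qed.

End Prox.
(** * Convex functions with domain the half-line *)

Section ConvexOnHalfLine.
Context {R : realType} (F : R -> \bar R).
Hypothesis FNy : forall x, F x != -oo%E.
Hypothesis Fcvx : econvex F.
Hypothesis Fdom : interior (edom F) = `]0, +oo[%classic.

Lemma gt0_fin_num x : 0 < x -> F x \is a fin_num.
Proof.
move=> x0; have : interior (edom F) x by rewrite Fdom /= in_itv/= x0.
by move=> /interior_subset/lt_eqF; rewrite fin_numE FNy /= => ->.
Qed.

Lemma lt0_pinfty x : x < 0 -> F x = +oo%E.
Proof.
move=> x0; apply/eqP/negPn/negP => Fx.
have [b Fb] : exists b, F x = b%:E.
  by move: Fx (FNy x); case: (F x) => [b| |] // _ _; exists b.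
suff : interior (edom F) (x / 2).
  by rewrite Fdom /= in_itv/= andbT; lra.
(* the open interval ]x, 1[ lies in the domain *)
rewrite /interior nbhsE /=; exists `]x, 1[%classic.
  split; [exact: interval_open|by rewrite /= in_itv/=; apply/andP; split; lra].
move=> y /=; rewrite in_itv/= => /andP[xy y1].
have t0 : 0 < (1 - y) / (1 - x) by rewrite divr_gt0//; lra.
have t1 : (1 - y) / (1 - x) < 1 by rewrite ltr_pdivrMr; lra.
have := Fcvx x 1 t0 t1.
have -> : (1 - y) / (1 - x) * x + (1 - (1 - y) / (1 - x)) * 1 = y.
  by field; lra.
have /fineK <- := gt0_fin_num ltr01.
by rewrite Fb -!EFinM -EFinD => /le_lt_trans; apply; rewrite ltry.
Qed.

Hypothesis Fdrv : forall x : R, 0 < x -> derivable (fine \o F) x 1.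

(** The tangent inequality: convexity bounds the difference quotients of [F]
    along the segment from [y] to [t] by [F t - F y]. *)
Lemma ederive_subgradient y : 0 < y -> subgradient F y (ederive F y).
Proof.
move=> y0 t; have yfin := gt0_fin_num y0.
have := FNy t; case E : (F t) => [a| |] // _; last by rewrite leey.
rewrite -(fineK yfin) -EFinD lee_fin -lerBrDl.
set f := fine \o F; set v := t - y.
have df : differentiable f y by apply/derivable1_diffP/Fdrv.
have -> : ederive F y * v = 'D_v f y.
  rewrite /ederive derive1E' // deriveE// mulrC.
  by rewrite -[_ * _]/(v *: _) -linearZ -[in RHS](mulr1 v).
have /cvg_dnbhs_at_right : (fun h => h^-1 *: ((f \o shift y) (h *: v) - f y))
    @ 0^' --> 'D_v f y by apply: diff_derivable.
move=> /cvgr_to_le; apply; near=> h.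
have h0 : 0 < h by near: h; exact: nbhs_right_gt.
have h1 : h < 1 by near: h; exact: nbhs_right_lt.
rewrite /= -[_ *: _]/(h^-1 * _) mulrC ler_pdivrMr//.
have := Fcvx t y h0 h1.
have -> : h * t + (1 - h) * y = h *: v + y by rewrite /v -[_ *: _]/(h * _); ring.
have [pos|] := boolP (F (h *: v + y) \is a fin_num).
  rewrite E -(fineK yfin) -(fineK pos) -!EFinM -EFinD lee_fin /f /=.
  lra.
rewrite E -(fineK yfin) -!EFinM -EFinD.
by have := FNy (h *: v + y); case: (F (h *: v + y)).
Unshelve. all: by end_near. Qed.

Lemma ederive_le x y : 0 < x -> x <= y -> ederive F x <= ederive F y.
Proof.
move=> x0; rewrite le_eqVlt => /predU1P[->//|xy].
have y0 : 0 < y by exact: lt_trans xy.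
have := ederive_subgradient x0 y; have := ederive_subgradient y0 x.
rewrite -(fineK (gt0_fin_num x0)) -(fineK (gt0_fin_num y0)) -!EFinD !lee_fin.
move=> h1 h2; have : 0 <= (y - x) * (ederive F y - ederive F x) by nra.
by rewrite pmulr_rge0 ?subr_gt0// subr_ge0.
Qed.

(** For fixed [h > 0] the tangent inequality at [x] gives
    [F'(x) <= (F(a + h) - F(x)) / (a + h - x)]. The right-hand side is continuous
    in [x] at [a], and its value at [a] is close to [F'(a)] when [h] is small.
    Negative [h] yields the lower bound. *)
Lemma ederive_continuous a : 0 < a -> {for a, continuous (ederive F)}.
Proof.
move=> a0; set f := fine \o F.
have fE x y : 0 < x -> 0 < y -> ederive F x * (y - x) <= f y - f x.
  move=> x0 y0; have := ederive_subgradient x0 y.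
  rewrite -(fineK (gt0_fin_num x0)) -(fineK (gt0_fin_num y0)) -!EFinD lee_fin.
  by rewrite lerBrDl.
have fc x : 0 < x -> {for x, continuous f}.
  by move=> x0; apply: differentiable_continuous; apply/derivable1_diffP/Fdrv.
have df : (fun h => h^-1 *: ((f \o shift a) (h *: 1) - f a)) @ 0^' -->
    ederive F a by rewrite /ederive derive1E; exact: Fdrv.
apply/cvgrPdist_lt => e e0.
have upper : \forall x \near a, ederive F x < ederive F a + e.
  near (0 : R)^'+ => h.
  have h0 : 0 < h by near: h; exact: nbhs_right_gt.
  have hq : (f (a + h) - f a) / (a + h - a) < ederive F a + e.
    rewrite [a + h]addrC addrK mulrC.
    near: h; have : \forall t \near (0 : R)^'+,
        t^-1 *: ((f \o shift a) (t *: 1) - f a) < ederive F a + e.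
      by apply: (cvgr_lt _ (cvg_dnbhs_at_right df)); rewrite ltrDl.
    by apply: filterS => h /=; rewrite -[_ *: _]/(_ * _) -[h *: 1]/(h * 1) mulr1.
  have qc : (f (a + h) - f x) / (a + h - x) @[x --> a] -->
      (f (a + h) - f a) / (a + h - a).
    apply: cvgM; first by apply: cvgB; [exact: cvg_cst|exact: fc].
    apply: cvgV; first by rewrite addrAC subrr add0r gt_eqF.
    by apply: cvgB; [exact: cvg_cst|exact: cvg_id].
  near=> x.
  have x0 : 0 < x by near: x; exact: lt_nbhsr.
  have xh : x < a + h by near: x; apply: lt_nbhsl; rewrite ltrDl.
  apply: (@le_lt_trans _ _ ((f (a + h) - f x) / (a + h - x))).
    by rewrite ler_pdivlMr ?subr_gt0// fE// addr_gt0.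
  by near: x; exact: (cvgr_lt _ qc).
have lower : \forall x \near a, ederive F a - e < ederive F x.
  near (0 : R)^'- => h.
  have h0 : h < 0 by near: h; exact: nbhs_left_lt.
  have ah : 0 < a + h.
    by rewrite -ltrBlDl sub0r; near: h; apply: nbhs_left_gt; rewrite oppr_lt0.
  have hq : ederive F a - e < (f (a + h) - f a) / (a + h - a).
    rewrite [a + h]addrC addrK mulrC.
    near: h; have : \forall t \near (0 : R)^'-,
        ederive F a - e < t^-1 *: ((f \o shift a) (t *: 1) - f a).
      by apply: (cvgr_gt _ (cvg_dnbhs_at_left df)); rewrite ltrBlDr ltrDl.
    by apply: filterS => h /=; rewrite -[_ *: _]/(_ * _) -[h *: 1]/(h * 1) mulr1.
  have qc : (f (a + h) - f x) / (a + h - x) @[x --> a] -->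
      (f (a + h) - f a) / (a + h - a).
    apply: cvgM; first by apply: cvgB; [exact: cvg_cst|exact: fc].
    apply: cvgV; first by rewrite addrAC subrr add0r lt_eqF.
    by apply: cvgB; [exact: cvg_cst|exact: cvg_id].
  near=> x.
  have x0 : 0 < x by near: x; exact: lt_nbhsr.
  have xh : a + h < x by near: x; apply: lt_nbhsr; rewrite gtrDl.
  apply: (@lt_le_trans _ _ ((f (a + h) - f x) / (a + h - x))).
    by near: x; exact: (cvgr_gt _ qc).
  by rewrite ler_ndivrMr ?subr_lt0// fE.
near=> x; rewrite distrC ltr_distl.
by apply/andP; split; near: x.
Unshelve. all: by end_near. Qed.

Hypothesis Flsc : lower_semicontinuous F.
Variable L0 : \bar R.
Hypothesis FL0 : (ederive F x)%:E @[x --> 0^'+] --> L0.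

Lemma near_ederive_lt b : (L0 < b%:E)%E ->
  \forall x \near 0^'+, ederive F x < b.
Proof.
move=> Lb; have /FL0 : nbhs L0 [set u | (u < b%:E)%E] by exact: open_ereal_lt'.
by rewrite nbhs_simpl/=; apply: filterS => x; rewrite /= lte_fin.
Qed.

Lemma limit_le_ederive x : 0 < x -> (L0 <= (ederive F x)%:E)%E.
Proof.
move=> x0; apply: (cvge_le _ FL0); near=> y.
by rewrite lee_fin ederive_le//; apply/ltW; near: y; exact: nbhs_right_lt.
Unshelve. all: by end_near. Qed.

(** At the boundary point 0 the subgradients of [F] are the [p <= L0]. That the
    value [F 0] is finite and lies below the tangents comes from lower
    semicontinuity. *)
Lemma subgradient_at0 l p : L0 = l%:E -> p <= l ->
  F 0 \is a fin_num /\ subgradient F 0 p.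
Proof.
move=> Ll pl.
(* limit as [x] tends to [0+] of [F x + L0 (t - x) <= F t] *)
have main t : 0 < t -> (F 0 + (l * t)%:E <= F t)%E.
  move=> t0; rewrite -leeBrDr// -(fineK (gt0_fin_num t0)) -EFinB.
  apply/lee_addgt0Pr => _/posnumP[e].
  rewrite leNgt; apply/negP => /Flsc[V V0 FV].
  have V0r : \forall x \near (0 : R)^'+, V x.
    exact: (@cvg_at_right_filter _ _ id (0 : R) _ cvg_id _ V0).
  near (0 : R)^'+ => x.
  have x0 : 0 < x by near: x; exact: nbhs_right_gt.
  have xt : x < t by near: x; exact: nbhs_right_lt.
  have /FV : V x by near: x.
  apply/negP; rewrite -leNgt.
  have l1 : 0 < `|l| + 1 by rewrite ltr_wpDl.
  have lx : l * x <= e%:num.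
    apply: (@le_trans _ _ ((`|l| + 1) * x)).
      by rewrite ler_pM2r// (le_trans (ler_norm l))// lerDl.
    rewrite mulrC -ler_pdivlMr//.
    by near: x; apply: nbhs_right_le; rewrite divr_gt0.
  have := ederive_subgradient x0 t.
  rewrite -(fineK (gt0_fin_num t0)) -(fineK (gt0_fin_num x0)) -!EFinD !lee_fin.
  have : l <= ederive F x by rewrite -lee_fin -Ll limit_le_ederive.
  move=> h1 h2; have : 0 <= (ederive F x - l) * (t - x).
    by rewrite mulr_ge0 ?subr_ge0// ltW.
  nra.
have F0 : F 0 \is a fin_num.
  rewrite fin_numE FNy /=; apply: contraTneq (main 1 ltr01) => ->.
  by rewrite addye// leye_eq; have := gt0_fin_num ltr01; rewrite fin_numE => /andP[].
split=> // t; rewrite subr0.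
have [t0|t0|->] := ltgtP t 0.
- by rewrite (lt0_pinfty t0) leey.
- by apply: le_trans (main _ t0); rewrite leeD2l// lee_fin ler_pM2r.
- by rewrite mulr0 adde0.
Unshelve. all: by end_near. Qed.

End ConvexOnHalfLine.

(** * The proximity operator of gamma (Phi + Psi) *)

Section Main.
Context {R : realType} (F : R -> \bar R).
Hypothesis FNy : forall x, F x != -oo%E.
Hypothesis Fcvx : econvex F.
Hypothesis Fdom : interior (edom F) = `]0, +oo[%classic.
Hypothesis Fdrv : forall x : R, 0 < x -> derivable (fine \o F) x 1.
Hypothesis Flsc : lower_semicontinuous F.
Variable L0 : \bar R.
Hypothesis FL0 : (ederive F x)%:E @[x --> 0^'+] --> L0.
Hypothesis L0y : L0 != +oo%E.
Variables (gamma : R) (rho : R).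
Hypothesis gamma_gt0 : 0 < gamma.

(** The one-dimensional proximal point is either the boundary point 0, where
    [L0] is finite and [rho <= gamma L0], or a positive critical point. *)
Lemma prox_line :
  (exists l, [/\ L0 = l%:E, rho <= gamma * l &
     prox_set Num.norm (fun x => (gamma%:E * F x)%E) rho = [set 0]]) \/
  (exists p, [/\ 0 < p, p + gamma * ederive F p = rho &
     prox_set Num.norm (fun x => (gamma%:E * F x)%E) rho = [set p]]).
Proof.
have [|] := leP (rho / gamma)%:E L0.
  move: FL0 L0y; case: L0 => [l| |] // Fl _.
  rewrite lee_fin ler_pdivrMr// mulrC => rl; left; exists l; split => //.
  have [|F0 Fp] := @subgradient_at0 R F FNy Fcvx Fdom Fdrv Flsc _ Fl l
      (rho / gamma) erefl.
    by rewrite ler_pdivrMr// mulrC.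
  apply: prox_subgradient Fp _ => //.
  by rewrite add0r mulrC divfK// gt_eqF.
move=> /lte_EFin_dense[b Lb]; rewrite ltr_pdivlMr// => br; right.
near (0 : R)^'+ => t.
have t0 : 0 < t by near: t; exact: nbhs_right_gt.
have ht : t < rho - b * gamma.
  by near: t; apply: nbhs_right_lt; rewrite subr_gt0.
have Ft : ederive F t < b by near: t; exact: near_ederive_lt FL0 _ Lb.
(* the derivative of the objective; its slope is at least 1, so it vanishes
   between [t] and [t - q t] *)
pose q x := x + gamma * ederive F x - rho.
have qt : q t < 0.
  by move: Ft; rewrite -(ltr_pM2l gamma_gt0) /q; lra.
have [|x tx|||p tp qp] := @root_itv R q t (t - q t).
- by lra.
- apply: cvgB; last exact: cvg_cst.
  apply: cvgD; first exact: cvg_id.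
  apply: cvgM; first exact: cvg_cst.
  by apply: (ederive_continuous FNy Fcvx Fdom Fdrv); exact: lt_le_trans tx.
- exact: ltW.
- have : ederive F t <= ederive F (t - q t).
    by apply: (ederive_le FNy Fcvx Fdom Fdrv) => //; lra.
  rewrite -(ler_pM2l gamma_gt0) /q; lra.
have p0 : 0 < p by exact: lt_le_trans tp.
exists p; split => //; first by move: qp; rewrite /q; lra.
apply: (@prox_subgradient R F gamma rho p (ederive F p)) => //.
- exact: gt0_fin_num.
- exact: ederive_subgradient.
- by move: qp; rewrite /q; lra.
Unshelve. all: by end_near. Qed.

Context {d : nat} (m : 'rV[R]_d).
Variables (alpha k : R).
Hypotheses (alpha_gt0 : 0 < alpha) (k_gt0 : 0 < k).

Let c := gamma * k ^+ 2 / alpha.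

Let c_gt0 : 0 < c.
Proof. by rewrite divr_gt0// mulr_gt0// exprn_gt0. Qed.

(** The denominator of [Rfun]. It equals [c] exactly at the positive critical
    points of [gamma F + |. - rho|^2 / 2]. *)
Definition Dfun (t : R) : R :=
  t + gamma * ederive F t - rho + gamma * k ^+ 2 / alpha.

Lemma RfunE t : Rfun F alpha k gamma rho m t =
  (k ^+ 2 * t + Dfun t) / Dfun t * Num.sqrt (Dfun t ^+ 2 - c ^+ 2)
  - k * enorm m.
Proof. by rewrite /Rfun /Dfun; congr (_ / _ * _ - _); ring. Qed.

Lemma Dfun_ge s t : 0 < s -> s <= t -> Dfun s + (t - s) <= Dfun t.
Proof.
move=> s0 st; have : ederive F s <= ederive F t by exact: ederive_le.
rewrite -(ler_pM2l gamma_gt0) /Dfun; lra.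
Qed.

Lemma Rfun_continuous t : 0 < t -> 0 < Dfun t ->
  {for t, continuous (Rfun F alpha k gamma rho m)}.
Proof.
move=> t0 Dt.
have Dc : Dfun x @[x --> t] --> Dfun t.
  apply: cvgD; last exact: cvg_cst.
  apply: cvgB; last exact: cvg_cst.
  apply: cvgD; first exact: cvg_id.
  apply: cvgM; first exact: cvg_cst.
  exact: ederive_continuous.
rewrite /prop_for /continuous_at (funext RfunE).
apply: cvgB; last exact: cvg_cst.
apply: cvgM.
  apply: cvgM; last by apply: (cvgV _ Dc); rewrite gt_eqF.
  apply: (cvgD _ Dc); apply: cvgM; [exact: cvg_cst|exact: cvg_id].
apply: continuous_cvg; first exact: sqrt_continuous.
by apply: cvgB; [exact: (cvgM Dc Dc)|exact: cvg_cst].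
Qed.

(** The upper end [t + k |m|] works because [D] has slope at least 1, so that
    [D >= c + k |m|] there. *)
Lemma Rfun_root t : 0 < t -> c <= Dfun t -> Rfun F alpha k gamma rho m t <= 0 ->
  exists2 theta, t <= theta & Rfun F alpha k gamma rho m theta = 0.
Proof.
move=> t0 cD Rt; have km : 0 <= k * enorm m.
  by rewrite mulr_ge0 ?enorm_ge0// ltW.
apply: (@root_itv R _ t (t + k * enorm m)) => //.
- by rewrite lerDl.
- move=> x tx; apply: Rfun_continuous; first exact: lt_le_trans tx.
  have := Dfun_ge t0 tx; have := c_gt0; lra.
have t1 : t <= t + k * enorm m by rewrite lerDl.
have := Dfun_ge t0 t1; have := c_gt0; rewrite RfunE.
set s := t + k * enorm m; set D := Dfun s => cg DD.
have s0 : 0 <= s by rewrite /s; lra.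
have Dkm : c + k * enorm m <= D by rewrite /s in DD; lra.
have D0 : 0 < D by lra.
rewrite subr_ge0; apply: (@le_trans _ _ (Num.sqrt (D ^+ 2 - c ^+ 2))).
  rewrite -[leLHS]ger0_norm// -sqrtr_sqr ler_wsqrtr//.
  have : 0 <= (D - (c + k * enorm m)) * (D + (c + k * enorm m)).
    by rewrite mulr_ge0 ?subr_ge0//; lra.
  have := mulr_ge0 (ltW cg) km; lra.
rewrite ler_peMl ?sqrtr_ge0// ler_pdivlMr// mul1r lerDr mulr_ge0//.
by rewrite sqr_ge0.
Qed.

(** At an admissible root, [v = lam m] with
    [sqrt (theta^2 - |v / k|^2) = theta c / D], and the two components of the
    gradient of the objective vanish. *)
Lemma prox_pair_pos theta : 0 < theta -> c <= Dfun theta ->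
  Rfun F alpha k gamma rho m theta = 0 ->
  prox_set (@pair_enorm R d)
    (fun x => (gamma%:E * (Phi alpha k x + Psi F x))%E) (rho, m)
    = [set (theta, vsol F alpha k gamma rho m theta)].
Proof.
move=> th0 cD; rewrite RfunE => /eqP; rewrite subr_eq0.
set D := Dfun theta in cD *; set q := Num.sqrt _ => /eqP Rq.
have D0 : 0 < D by have := c_gt0; lra.
have q2 : q ^+ 2 = D ^+ 2 - c ^+ 2.
  by rewrite sqr_sqrtr// subr_ge0; have := c_gt0; nra.
have q0 : 0 <= q by exact: sqrtr_ge0.
have kt0 : 0 < k ^+ 2 * theta by rewrite mulr_gt0// exprn_gt0.
pose lam := theta * k ^+ 2 / (k ^+ 2 * theta + D).
have -> : vsol F alpha k gamma rho m theta = lam *: m.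
  by rewrite /vsol /lam /D /Dfun; congr (_ / _ *: _); ring.
have lam0 : 0 < lam by apply: divr_gt0; [rewrite mulrC|exact: addr_gt0].
set v := lam *: m.
have ve : enorm (k^-1 *: v) = theta * q / D.
  rewrite !enormZ gtr0_norm ?invr_gt0// gtr0_norm//.
  have -> : enorm m = (k ^+ 2 * theta + D) / D * q / k.
    by rewrite Rq mulrC mulKf// gt_eqF.
  by rewrite /lam; field; rewrite !gt_eqF// addr_gt0.
have ve2 : enorm (k^-1 *: v) ^+ 2 = theta ^+ 2 * (D ^+ 2 - c ^+ 2) / D ^+ 2.
  by rewrite ve -q2; field; rewrite gt_eqF.
have qD : q <= D by have := c_gt0; nra.
have s2 : theta ^+ 2 - enorm (k^-1 *: v) ^+ 2 = (theta * c / D) ^+ 2.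
  by rewrite ve2; field; rewrite gt_eqF.
have s0 : 0 <= theta * c / D by apply/ltW/divr_gt0 => //; exact: mulr_gt0.
have vt : enorm (k^-1 *: v) <= theta.
  by rewrite ve ler_pdivrMr// ler_pM2l.
apply: prox_pair => //; first exact: gt0_fin_num.
move=> t w Ft wt; have := ederive_subgradient FNy Fcvx Fdom Fdrv th0 t.
have thf := gt0_fin_num FNy Fdom th0.
rewrite -(fineK Ft) -(fineK thf) -EFinD lee_fin /= => hF.
have hp := reverse_dotv_le wt vt.
rewrite s2 sqrtr_sqr (ger0_norm s0) dotvZl {2}/v !dotvZr in hp *.
set s := Num.sqrt _ in hp *.
(* the component of the optimality condition along [m] *)
have lamE : 1 - lam = D / theta * k^-1 * k^-1 * lam.
  by rewrite /lam; field; rewrite !gt_eqF// addr_gt0.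
(* from the reverse Cauchy-Schwarz inequality, rescaled by [D / theta] *)
have cs : c * s <= D * t - (1 - lam) * dotv w m.
  have Dth : 0 < D / theta by rewrite divr_gt0.
  rewrite -(ler_pM2l Dth) in hp.
  have -> : c * s = D / theta * (s * (theta * c / D)).
    by field; rewrite !gt_eqF.
  apply: le_trans hp _; rewrite lamE le_eqVlt; apply/orP; left; apply/eqP.
  by field; rewrite !gt_eqF.
have lM : (1 - lam) * lam * enorm m ^+ 2 = D * theta - c * (theta * c / D).
  have -> : D * theta - c * (theta * c / D) = D / theta * enorm (k^-1 *: v) ^+ 2.
    by rewrite ve2; field; rewrite !gt_eqF.
  rewrite !enormZ !exprMn !real_normK ?num_real// lamE.
  by field; rewrite !gt_eqF.
(* [F'] at the root, expressed through [D] *)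
have gF : gamma * ederive F theta = D - c + rho - theta.
  by rewrite /D /Dfun /c; ring.
rewrite -(ler_pM2l gamma_gt0) mulrDr mulrA gF in hF.
rewrite -/c !enormB_sqr enormZ exprMn (gtr0_norm lam0) dotvZl dotvZr.
rewrite -[dotv m m]enorm_sqr.
lra.
Qed.

Lemma prox_pair_zero l : L0 = l%:E ->
  threshold alpha k gamma rho m <= gamma * l ->
  prox_set (@pair_enorm R d)
    (fun x => (gamma%:E * (Phi alpha k x + Psi F x))%E) (rho, m)
    = [set (0, 0)].
Proof.
move=> Ll; rewrite /threshold -/c => tl.
have [F0 sub] := subgradient_at0 FNy Fcvx Fdom Fdrv Flsc FL0 Ll (lexx l).
apply: prox_pair => //; first by rewrite scaler0 enorm0.
move=> t w Ft wt; move: (sub t).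
rewrite -(fineK Ft) -(fineK F0) -EFinD lee_fin /= subr0 => hF.
rewrite -(ler_pM2l gamma_gt0) mulrDr mulrA in hF.
set a := enorm (k^-1 *: w) in wt *.
have a0 : 0 <= a by exact: enorm_ge0.
have M0 := enorm_ge0 m.
have t0 : 0 <= t by exact: le_trans wt.
set s := Num.sqrt (t ^+ 2 - a ^+ 2).
have s0 : 0 <= s by exact: sqrtr_ge0.
have s2 : s ^+ 2 = t ^+ 2 - a ^+ 2 by rewrite sqr_sqrtr//; nra.
set S := Num.sqrt _ in tl.
have S0 : 0 <= S by exact: sqrtr_ge0.
have S2 : S ^+ 2 = c ^+ 2 + k ^+ 2 * enorm m ^+ 2.
  by rewrite sqr_sqrtr// -exprMn addr_ge0// sqr_ge0.
(* Cauchy-Schwarz for [(a, s)] and [(k |m|, c)], whose norms are [t] and [S] *)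
have ktm : a * (k * enorm m) + c * s <= t * S.
  have km0 : 0 <= k * enorm m by rewrite mulr_ge0// ltW.
  have := ltW c_gt0 => c0.
  have A0 : 0 <= a * (k * enorm m) + c * s by apply: addr_ge0; exact: mulr_ge0.
  have B0 : 0 <= t * S by exact: mulr_ge0.
  rewrite -ler_sqr ?nnegrE// -subr_ge0.
  rewrite [X in 0 <= X](_ : _ = (c * a - s * (k * enorm m)) ^+ 2) ?sqr_ge0//.
  have -> : (t * S) ^+ 2 = t ^+ 2 * S ^+ 2 by rewrite exprMn.
  rewrite S2 (_ : t ^+ 2 = s ^+ 2 + a ^+ 2); first by ring.
  by rewrite s2 subrK.
have wm : dotv w m <= a * (k * enorm m).
  apply: le_trans (dotv_le w m) _.
  rewrite /a enormZ gtr0_norm ?invr_gt0//.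
  by rewrite mulrACA mulVf ?mul1r ?gt_eqF.
have ht : t * S <= t * (c + gamma * l - rho) by rewrite ler_wpM2l//; lra.
rewrite -/c scaler0 enorm0 expr0n/= subrr sqrtr0 !sub0r !subr0 sqrrN enormB_sqr.
rewrite -(scaleN1r m) enormZ normrN1 mul1r.
lra.
Qed.

(* the one-dimensional proximal point *)
Let pr := prox Num.norm (fun x => (gamma%:E * F x)%E) rho.

Lemma prox_line_ge0 : 0 <= pr.
Proof.
by case: prox_line => [[l [_ _ /prox_eq prE]]|[p [/ltW p0 _ /prox_eq prE]]];
  rewrite /pr prE.
Qed.

Lemma Dfun_ge_prox t : 0 < t -> pr <= t -> c <= Dfun t.
Proof.
move=> t0.
case: prox_line => [[l [Ll rl /prox_eq prE]]|[p [p0 pE /prox_eq prE]]];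
  rewrite /pr prE => pt.
- have : l <= ederive F t.
    by rewrite -lee_fin -Ll; exact: (limit_le_ederive FNy Fcvx Fdom Fdrv FL0).
  rewrite -(ler_pM2l gamma_gt0) /Dfun -/c; lra.
- by have := Dfun_ge p0 pt; rewrite /Dfun -/c; lra.
Qed.

Lemma Rfun_exists_root :
  (gamma%:E * L0 < (threshold alpha k gamma rho m)%:E)%E ->
  exists theta, [/\ 0 < theta, pr <= theta & Rfun F alpha k gamma rho m theta = 0].
Proof.
move=> L0t; have km0 : 0 <= k * enorm m by rewrite mulr_ge0 ?enorm_ge0// ltW.
suff [t [t0 prt Rt]] :
    exists t, [/\ 0 < t, pr <= t & Rfun F alpha k gamma rho m t <= 0].
  have [th tth Rth] := Rfun_root t0 (Dfun_ge_prox t0 prt) Rt.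
  by exists th; split => //; [exact: lt_le_trans tth|exact: le_trans tth].
case: prox_line => [[l [Ll rl /prox_eq prE]]|[p [p0 pE /prox_eq prE]]];
  rewrite /pr prE; last first.
  exists p; split => //; rewrite RfunE.
  have -> : Dfun p = c by rewrite /Dfun -/c; lra.
  by rewrite subrr sqrtr0 mulr0 sub0r oppr_le0.
move: L0t; rewrite Ll -EFinM lte_fin /threshold -/c => lt.
set S := Num.sqrt _ in lt.
have S2 : S ^+ 2 = c ^+ 2 + (k * enorm m) ^+ 2.
  by rewrite [(k * _) ^+ 2]exprMn sqr_sqrtr// -exprMn addr_ge0// sqr_ge0.
(* [b] leaves room between [L0] and the threshold *)
have [b lb bS] : exists2 b, l < b & gamma * b < rho + S - c.
  have : l < (rho + S - c) / gamma by rewrite ltr_pdivlMr// mulrC.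
  move=> h; exists ((l + (rho + S - c) / gamma) / 2); first by lra.
  rewrite mulrC -ltr_pdivlMr//; lra.
have glb : gamma * l < gamma * b by rewrite ltr_pM2l.
(* [G] bounds [R] from above where [F' < b], because [c <= D <= E] there *)
pose E t := t + (gamma * b - rho + c).
pose G t := (1 + k ^+ 2 * t / c) * Num.sqrt (E t ^+ 2 - c ^+ 2) - k * enorm m.
have G0 : G 0 < 0.
  rewrite /G mulr0 mul0r addr0 mul1r subr_lt0 -[ltRHS]ger0_norm// -sqrtr_sqr.
  have := c_gt0 => cg.
  have E0 : 0 <= E 0 by rewrite /E; lra.
  have E0S : E 0 < S by rewrite /E; lra.
  have E2S2 : E 0 ^+ 2 < S ^+ 2 by rewrite ltr_pXn2r// nnegrE ltW// (le_lt_trans E0).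
  have km2 : 0 < (k * enorm m) ^+ 2.
    have : c ^+ 2 <= E 0 ^+ 2 by rewrite ler_pXn2r ?nnegrE// ?ltW// /E; lra.
    lra.
  by rewrite ltr_sqrt//; lra.
have Gc : G x @[x --> (0 : R)] --> G 0.
  have Ec : E x @[x --> (0 : R)] --> E 0.
    by apply: cvgD; [exact: cvg_id|exact: cvg_cst].
  apply: cvgB; last exact: cvg_cst.
  apply: cvgM.
    apply: cvgD; first exact: cvg_cst.
    apply: cvgM; last exact: cvg_cst.
    by apply: cvgM; [exact: cvg_cst|exact: cvg_id].
  apply: continuous_cvg; first exact: sqrt_continuous.
  by apply: cvgB; [exact: (cvgM Ec Ec)|exact: cvg_cst].
near (0 : R)^'+ => t.
have t0 : 0 < t by near: t; exact: nbhs_right_gt.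
have Fb : ederive F t < b.
  by near: t; apply: (near_ederive_lt FL0); rewrite Ll lte_fin.
have Gt : G t < 0 by near: t; exact: (cvgr_lt _ (cvg_at_right_filter Gc)).
have cD : c <= Dfun t by apply: Dfun_ge_prox; rewrite // /pr prE ltW.
exists t; split; [by []|exact: ltW|].
apply: ltW; apply: le_lt_trans Gt.
rewrite RfunE lerD2r; have := c_gt0 => cg.
have D0 : 0 < Dfun t by lra.
have DE : Dfun t <= E t.
  by move: Fb; rewrite -(ltr_pM2l gamma_gt0) /Dfun /E -/c; lra.
apply: ler_pM; rewrite ?sqrtr_ge0//.
- by rewrite divr_ge0// ?ltW// addr_gt0// mulr_gt0// exprn_gt0.
- rewrite mulrDl divff ?gt_eqF// addrC lerD2l ler_pM2l ?lef_pV2//.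
  by rewrite mulr_gt0// exprn_gt0.
- have E0 : 0 < E t by exact: lt_le_trans DE.
  by rewrite ler_wsqrtr// lerD2r ler_pXn2r// nnegrE ltW.
Unshelve. all: by end_near. Qed.

End Main.

Theorem proposition4p3 (R : realType) (d : nat) (hd : (1 <= d)%N)
    (F : R -> \bar R) (hFNy : forall x, F x != -oo%E)
    (hFlsc : lower_semicontinuous F) (hFcvx : econvex F)
    (hFdom : interior (edom F) = `]0, +oo[%classic)
    (hFdrv : forall xi : R, 0 < xi -> derivable (fine \o F) xi 1)
    (L0 : \bar R) (hL0 : (ederive F xi)%:E @[xi --> 0^'+] --> L0)
    (hL0y : L0 != +oo%E)
    (alpha k : R) (halpha : 0 < alpha) (hk : 0 < k)
    (gamma : R) (hgamma : 0 < gamma) (rho : R) (m : 'rV[R]_d) :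
  let gF : R -> \bar R := fun x => (gamma%:E * F x)%E in
  let gPhiPsi : R * 'rV[R]_d -> \bar R :=
    fun x => (gamma%:E * (Phi alpha k x + Psi F x))%E in
  [/\ prox_set Num.norm gF rho = [set prox Num.norm gF rho],
      prox_set (@pair_enorm R d) gPhiPsi (rho, m)
        = [set prox (@pair_enorm R d) gPhiPsi (rho, m)],
      ((threshold alpha k gamma rho m)%:E <= gamma%:E * L0)%E ->
        prox (@pair_enorm R d) gPhiPsi (rho, m) = (0, 0)
    & ((threshold alpha k gamma rho m)%:E > gamma%:E * L0)%E ->
        0 <= prox Num.norm gF rho /\
        exists theta : R,
          unique (fun t => [/\ 0 < t, prox Num.norm gF rho <= t
                             & Rfun F alpha k gamma rho m t = 0]) theta /\
          prox (@pair_enorm R d) gPhiPsi (rho, m)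
            = (theta, vsol F alpha k gamma rho m theta)].
Proof.
move=> gF gPhiPsi.
have line := prox_line hFNy hFcvx hFdom hFdrv hFlsc hL0 hL0y rho hgamma.
have zero : ((threshold alpha k gamma rho m)%:E <= gamma%:E * L0)%E ->
    prox_set (@pair_enorm R d) gPhiPsi (rho, m) = [set (0, 0)].
  move=> tL; have [l Ll] : exists l, L0 = l%:E.
    move: tL hL0y; case: (L0) => [l| |] //; first by exists l.
    by rewrite gt0_muleNy ?lte_fin.
  move: tL; rewrite Ll -EFinM lee_fin.
  exact: (prox_pair_zero hFNy hFcvx hFdom hFdrv hFlsc hL0).
have pos t : 0 < t -> prox Num.norm gF rho <= t ->
    Rfun F alpha k gamma rho m t = 0 ->
    prox_set (@pair_enorm R d) gPhiPsi (rho, m)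
      = [set (t, vsol F alpha k gamma rho m t)].
  move=> t0 pt; apply: (prox_pair_pos hFNy hFcvx hFdom hFdrv) => //.
  exact: (Dfun_ge_prox hFNy hFcvx hFdom hFdrv hFlsc hL0).
have root := Rfun_exists_root hFNy hFcvx hFdom hFdrv hFlsc hL0 hL0y hgamma
  halpha hk.
split.
- by case: line => [[l [_ _ pE]]|[p [_ _ pE]]]; rewrite (prox_eq pE).
- have [/zero pE|/root[t [t0 pt Rt]]] :=
      leP (threshold alpha k gamma rho m)%:E (gamma%:E * L0)%E.
    by rewrite (prox_eq pE).
  by have pE := pos _ t0 pt Rt; rewrite (prox_eq pE).
- by move=> /zero/prox_eq.
- move=> /root[t [t0 pt Rt]]; have /prox_eq pE := pos _ t0 pt Rt.
  split; first exact: (prox_line_ge0 hFNy hFcvx hFdom hFdrv hFlsc hL0).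
  exists t; split => //; split => // s [s0 ps Rs].
  by have /prox_eq := pos _ s0 ps Rs; rewrite pE => -[].
Qed.
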